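(* Let $\epsilon \in (0,1)$, let $N$ be a natural number, and let $\Gamma$ be a subgroup of $\mathrm{Diff}_{+}^{1+\epsilon}(I)$ such that every non-identity element of $\Gamma$ has at most $N$ fixed points in $(0,1)$. Then $\Gamma$ is solvable.
   Context: $I=[0,1]$. $\mathrm{Diff}_{+}^{1+\epsilon}(I)$ denotes the group (under composition) of orientation-preserving $C^1$ diffeomorphisms of $I$ whose derivative is $\epsilon$-Hölder continuous. Fixed points are counted in the open interval $(0,1)$. *)

(* Defs.v *)
From HB Require Import structures.
From mathcomp Require Import all_boot all_order all_algebra.
From mathcomp Require Import all_classical all_reals all_analysis.
From mathcomp Require Import lra.
Import Order.TTheory GRing.Theory Num.Theory.
Import numFieldNormedType.Exports.

Set Implicit Arguments.
Unset Strict Implicit.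
Unset Printing Implicit Defensive.

Local Open Scope classical_set_scope.
Local Open Scope ring_scope.

Section Solvable.
Local Open Scope group_scope.
Variable G : groupType.
Implicit Types H : set G.

Definition subgroup H : Prop := group_closed [in H].

Definition commutator_subgroup H : set G :=
  smallest subgroup [set z | exists x y, [/\ H x, H y & z = [~ x, y]]].

Fixpoint derived_series H (n : nat) : set G :=
  if n is m.+1 then commutator_subgroup (derived_series H m) else H.

Definition solvable_subgroup H : Prop :=
  exists n, derived_series H n = [set 1].
End Solvable.

Definition I01 (R : realType) : set R := `[0, 1].
Arguments I01 : clear implicits.

Section Defs.
Variable R : realType.
Implicit Types (f g : I01 R -> I01 R) (df : I01 R -> R) (e : R).

(* The limit is taken in the subspace [0, 1], so the derivative is one-sided at
   0 and at 1. *)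
Definition derivative_on f df : Prop :=
  forall x : I01 R,
    (\val (f y) - \val (f x)) / (\val y - \val x) @[y --> x^'] --> df x.

Definition C1_map f : Prop := exists2 df, derivative_on f df & continuous df.

Definition holder e df : Prop :=
  exists C : R, forall x y : I01 R,
    `|df x - df y| <= C * `|\val x - \val y| `^ e.

Definition C1_diffeo f : Prop :=
  exists g, [/\ cancel f g, cancel g f, C1_map f & C1_map g].

Definition orientation_preserving f : Prop :=
  forall x y : I01 R, \val x < \val y -> \val (f x) < \val (f y).

Definition C1e_diffeo_plus e f : Prop :=
  [/\ C1_diffeo f, orientation_preserving f
    & exists2 df, derivative_on f df & holder e df].

End Defs.

Record diff_plus (R : realType) (e : R) := DiffPlus {
  diff_fun :> I01 R -> I01 R;
  diff_funP : C1e_diffeo_plus e diff_fun }.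

Section Group.
Variable R : realType.
Implicit Types (f g : I01 R -> I01 R) (df dg h : I01 R -> R) (e : R) (x y : I01 R).

Lemma I01P x : 0 <= \val x <= 1.
Proof. by have := set_valP x; rewrite /I01 /= in_itv. Qed.

Lemma clip_subproof (r : R) : Num.max 0 (Num.min 1 r) \in I01 R.
Proof.
by rewrite inE /I01 /= in_itv /= le_max lexx /= ge_max ler01 /= ge_min lexx.
Qed.

Definition clip (r : R) : I01 R := SigSub (clip_subproof r).

Lemma val_clip (r : R) : 0 <= r <= 1 -> \val (clip r) = r.
Proof. by case/andP=> r0 r1 /=; rewrite (min_idPr r1) (max_idPr r0). Qed.

Lemma clip_val x : clip (\val x) = x.
Proof. by apply: val_inj; apply: val_clip; exact: I01P. Qed.

Lemma continuous_clip : continuous clip.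
Proof.
apply: (@continuous_comp_initial _ _ _ (@set_val _ (I01 R))) => r.
apply: (@continuous_max _ _ (cst 0) (fun r : R => Num.min 1 r)).
  exact: cst_continuous.
apply: (@continuous_min _ _ (cst 1) (fun r : R => r)).
  exact: cst_continuous.
exact: cvg_id.
Qed.

Lemma continuous_val : continuous (\val : I01 R -> R).
Proof. exact: initial_continuous. Qed.

Lemma dnbhs_I01_proper x : ProperFilter x^'.
Proof.
apply: Build_ProperFilter_ex => A.
rewrite /dnbhs /within /= => /nbhs_ballP[r /= r0 xA].
have /andP[x0 x1] := I01P x.
have [y] : exists y : I01 R, `|\val x - \val y| < r /\ y != x.
  pose d := Num.min (r / 2) (1 / 2).
  have d0 : 0 < d by rewrite lt_min !divr_gt0.
  have dr : d < r by rewrite gt_min ltr_pdivrMr// ltr_pMr// ltr1n.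
  have d2 : d <= 1 / 2 by rewrite ge_min lexx orbT.
  have [xle|xge] := leP (\val x) (1 / 2).
    have h : 0 <= \val x + d <= 1 by apply/andP; split; lra.
    exists (clip (\val x + d)); rewrite val_clip//.
    rewrite opprD addrA subrr add0r normrN gtr0_norm//; split=> //.
    by apply/eqP => /(congr1 \val); rewrite val_clip// => ?; lra.
  have h : 0 <= \val x - d <= 1 by apply/andP; split; lra.
  exists (clip (\val x - d)); rewrite val_clip//.
  rewrite opprB addrCA subrr addr0 gtr0_norm//; split=> //.
  by apply/eqP => /(congr1 \val); rewrite val_clip// => ?; lra.
by move=> [xy yx]; exists y; apply: xA.
Qed.

Lemma derivative_on_continuous f df : derivative_on f df -> continuous f.
Proof.
move=> fdf.
apply: (@continuous_comp_initial _ _ _ (@set_val _ (I01 R))) => x.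
apply/continuous_withinNx.
have lim0 : \val y - \val x @[y --> x^'] --> 0.
  rewrite -(subrr (\val x)).
  apply: (@cvgB _ R^o _ _ _ (\val : I01 R -> R)); last exact: cvg_cst.
  by apply: (@cvg_within_filter); exact: continuous_val.
have H : \val (f x) + (\val (f y) - \val (f x)) / (\val y - \val x) *
    (\val y - \val x) @[y --> x^'] --> \val (f x) + df x * 0.
  by apply: cvgD; [exact: cvg_cst | exact: cvgM (fdf x) lim0].
rewrite mulr0 addr0 in H; apply: (cvg_trans _ H); apply: near_eq_cvg.
near=> y => /=.
rewrite divfK; first by rewrite addrC subrK.
by rewrite subr_eq0 (inj_eq val_inj); near: y; exact: nbhs_dnbhs_neq.
Unshelve. all: by end_near. Qed.

Lemma derivative_on_comp f df g dg : injective g ->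
  derivative_on f df -> derivative_on g dg ->
  derivative_on (f \o g) (fun x => df (g x) * dg x).
Proof.
move=> gi fdf gdg x.
have gx : g @ x^' --> (g x)^'.
  apply: continuous_injective_withinNx; last by move=> y; exact: gi.
  exact: derivative_on_continuous gdg x.
have H : (\val (f (g y)) - \val (f (g x))) / (\val (g y) - \val (g x)) *
    ((\val (g y) - \val (g x)) / (\val y - \val x))
    @[y --> x^'] --> df (g x) * dg x.
  by apply: cvgM (gdg x); exact: cvg_comp _ _ gx (fdf (g x)).
apply: (cvg_trans _ H); apply: near_eq_cvg; near=> y => /=.
rewrite mulrA divfK//.
rewrite subr_eq0 (inj_eq val_inj) (inj_eq gi); near: y.
exact: nbhs_dnbhs_neq.
Unshelve. all: by end_near. Qed.

Lemma derivative_on_id : derivative_on id (cst (1 : R)).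
Proof.
move=> x; apply: (cvg_trans _ (@cvg_cst R 1 _ x^' _)).
apply: near_eq_cvg; near=> y => /=.
rewrite divff// subr_eq0 (inj_eq val_inj); near: y.
exact: nbhs_dnbhs_neq.
Unshelve. all: by end_near. Qed.

Lemma derivative_on_unique f df df' :
  derivative_on f df -> derivative_on f df' -> df = df'.
Proof.
move=> h h'; apply/funext => x; have P := dnbhs_I01_proper x.
exact: cvg_unique (h x) (h' x).
Qed.

Lemma derivative_on_is_derive f df (r : R) : derivative_on f df ->
  0 < r < 1 -> is_derive r 1 (\val \o f \o clip) (df (clip r)).
Proof.
move=> fdf r01.
suff cv : h^-1 *: ((\val \o f \o clip) (h *: 1 + r) - (\val \o f \o clip) r)
    @[h --> 0^'] --> df (clip r).
  by apply: DeriveDef; [apply/cvg_ex; exists (df (clip r)) | exact/cvg_lim].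
pose s (h : R) := clip (h + r).
have sc : {for 0, continuous s}.
  apply: continuous_comp; last exact: continuous_clip.
  by apply: cvgD; [exact: cvg_id | exact: cvg_cst].
have near01 : \forall h \near 0^', 0 <= h + r <= 1.
  have /andP[r0 r1] := r01.
  pose d := Num.min r (1 - r).
  have d0 : 0 < d by rewrite lt_min r0 subr_gt0.
  near=> h; have : `|h| < d.
    by near: h; exact: dnbhs0_lt.
  rewrite lt_min !ltr_norml => /andP[/andP[a b] /andP[c e']].
  by apply/andP; split; lra.
have sr : s @ 0^' --> (clip r)^'.
  move=> A rA0.
  have rA : \forall y \near clip r, y != clip r -> A y by exact: rA0.
  have sA : \forall h \near 0^', s h != clip r -> A (s h).
    have s0 : s 0 = clip r by rewrite /s add0r.
    by apply: nbhs_dnbhs; rewrite -s0 in rA *; exact: sc rA.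
  suff : \forall h \near 0^', A (s h) by [].
  near=> h.
  have hA : s h != clip r -> A (s h) by near: h.
  apply: hA; apply/eqP => /(congr1 \val).
  have /andP[r0 r1] := r01.
  rewrite val_clip; last by near: h.
  rewrite val_clip ?(ltW r0) ?(ltW r1)// => /eqP.
  rewrite -subr_eq0 addrK; apply/negP; near: h; exact: nbhs_dnbhs_neq.
have H := cvg_comp _ _ sr (fdf (clip r)).
apply: (cvg_trans _ H); apply: near_eq_cvg; near=> h => /=.
have hr : 0 <= h + r <= 1 by near: h.
have /andP[r0 r1] := r01.
have rr : 0 <= r <= 1 by rewrite (ltW r0) (ltW r1).
have := val_clip hr; have := val_clip rr; rewrite /= => -> ->.
by rewrite [h *: 1]mulr1 addrK mulrC.
Unshelve. all: by end_near. Qed.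

Lemma continuous_on_bounded h : continuous h ->
  exists2 M, 0 <= M & forall x, `|h x| <= M.
Proof.
move=> hc.
have c : {within `[0, 1], continuous (fun r => `|h (clip r)|)}.
  apply: continuous_subspaceT => r; apply: cvg_norm.
  by apply: continuous_comp; [exact: continuous_clip | exact: hc].
have [t _ tM] := EVT_max ler01 c.
exists `|h (clip t)| => // x; have := tM (\val x).
by rewrite clip_val in_itv /=; apply; exact: I01P.
Qed.

Lemma C1_map_lipschitz f : C1_map f ->
  exists2 L, 0 <= L & forall x y,
    `|\val (f x) - \val (f y)| <= L * `|\val x - \val y|.
Proof.
move=> [df fdf dfc]; have [L L0 dfL] := continuous_on_bounded dfc.
exists L => // x y; wlog xy : x y / \val x <= \val y.
  move=> H; have [xy|yx] := leP (\val x) (\val y); first exact: H.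
  by rewrite distrC [X in _ * X]distrC; apply: H; exact: ltW.
have [||c _] := @MVT_segment R (\val \o f \o clip) (df \o clip) _ _ xy.
- move=> r; rewrite in_itv /= => /andP[xr ry].
  apply: derivative_on_is_derive => //.
  have /andP[x0 _] := I01P x; have /andP[_ y1] := I01P y.
  by rewrite (le_lt_trans x0 xr) (lt_le_trans ry y1).
- apply: continuous_subspaceT => r.
  apply: continuous_comp; first exact: continuous_clip.
  apply: continuous_comp; last exact: continuous_val.
  exact: derivative_on_continuous fdf _.
rewrite /comp !clip_val => fE.
by rewrite distrC fE normrM [X in _ <= _ * X]distrC ler_wpM2r.
Qed.

Lemma dist_I01 x y : `|\val x - \val y| <= 1.
Proof.
have /andP[? ?] := I01P x; have /andP[? ?] := I01P y.
by rewrite ler_norml; apply/andP; split; lra.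
Qed.

Lemma bounded_holder e h : e <= 0 -> continuous h -> holder e h.
Proof.
move=> e0 /continuous_on_bounded[M M0 hM]; exists (M + M) => x y.
have [->|xy] := eqVneq x y.
  by rewrite !subrr normr0 mulr_ge0 ?addr_ge0 ?powR_ge0.
apply: (le_trans (ler_normB _ _)); apply: (le_trans (lerD (hM x) (hM y))).
rewrite ler_peMr ?addr_ge0// -(powRr0 `|\val x - \val y|).
apply: ger_powR => //.
by rewrite dist_I01 normr_gt0 subr_eq0 (inj_eq val_inj) xy.
Qed.

Lemma holder_mul e df dg : continuous df -> continuous dg ->
  holder e df -> holder e dg -> holder e (fun x => df x * dg x).
Proof.
move=> /continuous_on_bounded[M M0 hM] /continuous_on_bounded[N N0 hN].
move=> [C hC] [D hD]; exists (M * D + C * N) => x y.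
have -> : df x * dg x - df y * dg y =
    df x * (dg x - dg y) + (df x - df y) * dg y.
  by rewrite mulrBr mulrBl addrA subrK.
apply: (le_trans (ler_normD _ _)); rewrite !normrM mulrDl lerD//.
  by rewrite -mulrA ler_pM.
by rewrite mulrAC ler_pM.
Qed.

Lemma holder_comp e f df : C1_map f -> continuous df -> holder e df ->
  holder e (df \o f).
Proof.
move=> f1 dfc [C hC]; have [e0|e0] := leP e 0.
  apply: bounded_holder => // x; apply: continuous_comp; last exact: dfc.
  by case: f1 => d fd _; exact: derivative_on_continuous fd x.
have [L L0 fL] := C1_map_lipschitz f1.
exists (`|C| * L `^ e) => x y; apply: (le_trans (hC _ _)).
rewrite -mulrA -powRM//; apply: (@le_trans _ _ (`|C| * `|\val (f x) - \val (f y)| `^ e)).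
  by rewrite ler_wpM2r ?powR_ge0 ?ler_norm.
rewrite ler_wpM2l// ge0_ler_powR ?nnegrE ?mulr_ge0//; exact: ltW.
Qed.

Lemma C1_map_comp f g : injective g -> C1_map f -> C1_map g ->
  C1_map (f \o g).
Proof.
move=> gi [df fdf dfc] [dg gdg dgc].
exists (fun x => df (g x) * dg x); first exact: derivative_on_comp.
have dfgc : continuous (df \o g).
  move=> x; apply: continuous_comp; last exact: dfc.
  exact: derivative_on_continuous gdg x.
by move=> x; exact: cvgM (dfgc x) (dgc x).
Qed.

Lemma C1_map_id : C1_map (@id (I01 R)).
Proof.
exists (cst 1); [exact: derivative_on_id | exact: cst_continuous].
Qed.

Lemma C1e_diffeo_plus_id e : C1e_diffeo_plus e id.
Proof.
split=> //; first by exists id; split=> //; exact: C1_map_id.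
exists (cst 1); first exact: derivative_on_id.
by exists 0 => x y; rewrite subrr normr0 mul0r.
Qed.

Lemma C1e_diffeo_plus_comp e f g :
  C1e_diffeo_plus e f -> C1e_diffeo_plus e g -> C1e_diffeo_plus e (f \o g).
Proof.
move=> [[f' [fK f'K f1 f'1]] fo [df fdf dfe]].
move=> [[g' [gK g'K g1 g'1]] go [dg gdg dge]]; split.
- exists (g' \o f'); split.
  + exact: can_comp.
  + exact: can_comp.
  + by apply: C1_map_comp => //; exact: can_inj gK.
  + by apply: C1_map_comp => //; exact: can_inj f'K.
- by move=> x y xy; apply/fo/go.
- have dfc : continuous df.
    by case: f1 => d fd dc; rewrite (derivative_on_unique fdf fd).
  have dgc : continuous dg.
    by case: g1 => d gd dc; rewrite (derivative_on_unique gdg gd).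
  exists (fun x => df (g x) * dg x).
    by apply: derivative_on_comp => //; exact: can_inj gK.
  apply: (@holder_mul e (df \o g)) => //.
    move=> x; apply: continuous_comp; last exact: dfc.
    exact: derivative_on_continuous gdg x.
  exact: holder_comp.
Qed.

Lemma C1e_diffeo_plus_inv e f g : cancel f g -> cancel g f ->
  C1e_diffeo_plus e f -> C1e_diffeo_plus e g.
Proof.
move=> fK gK [[g0 [fK0 gK0 f1 g1]] fo [df fdf dfe]].
have g0E : g0 = g by apply/funext => x; rewrite -[x in LHS]gK fK0.
rewrite {}g0E {fK0 gK0} in g1.
split; first by exists f.
  move=> x y xy; rewrite ltNge; apply/negP.
  rewrite le_eqVlt => /orP[/eqP/val_inj/(can_inj gK) yx|/fo].
    by rewrite yx ltxx in xy.
  by rewrite !gK => /(lt_trans xy); rewrite ltxx.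
have [dg gdg dgc] := g1; exists dg => //.
have dfc : continuous df.
  by case: f1 => d fd dc; rewrite (derivative_on_unique fdf fd).
have dfg1 x : df (g x) * dg x = 1.
  have fgE : f \o g = id by apply/funext => z /=; rewrite gK.
  have := derivative_on_comp (can_inj gK) fdf gdg; rewrite fgE.
  by move=> /derivative_on_unique/(_ derivative_on_id)/(congr1 (@^~ x)).
have [C hC] : holder e (df \o g) by exact: holder_comp.
have [M M0 hM] := continuous_on_bounded dgc.
exists (M * M * C) => x y.
have -> : dg x - dg y = dg x * dg y * (df (g y) - df (g x)).
  by rewrite mulrBr -mulrA [dg y * df _]mulrC dfg1 mulr1 mulrAC
    [dg x * df _]mulrC dfg1 mul1r.
rewrite !normrM [`|_ - df _|]distrC -[leRHS]mulrA.
by apply: ler_pM; rewrite ?mulr_ge0 ?ler_pM//; exact: hC.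
Qed.

End Group.

Section GroupInstance.
Variables (R : realType) (e : R).
Implicit Types a b c : diff_plus e.

Lemma diff_plus_inj a b : diff_fun a = diff_fun b -> a = b.
Proof. by case: a b => f fP [g gP] /= fg; subst g; congr DiffPlus. Qed.

Lemma diff_inv_subproof a : exists g : I01 R -> I01 R, cancel a g /\ cancel g a.
Proof. by have [[g [aK Ka _ _]] _ _] := diff_funP a; exists g. Qed.

Definition diff_inv_fun a : I01 R -> I01 R :=
  projT1 (cid (diff_inv_subproof a)).

Lemma diff_funK a : cancel a (diff_inv_fun a).
Proof. by rewrite /diff_inv_fun; case: cid => g [] /=. Qed.

Lemma diff_inv_funK a : cancel (diff_inv_fun a) a.
Proof. by rewrite /diff_inv_fun; case: cid => g [] /=. Qed.

Definition diff_one : diff_plus e := DiffPlus (C1e_diffeo_plus_id e).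

Definition diff_mul a b : diff_plus e :=
  DiffPlus (C1e_diffeo_plus_comp (diff_funP a) (diff_funP b)).

Definition diff_inv a : diff_plus e :=
  DiffPlus (C1e_diffeo_plus_inv (diff_funK a) (diff_inv_funK a) (diff_funP a)).

Lemma diff_mulA : associative diff_mul.
Proof. by move=> a b c; exact: diff_plus_inj. Qed.

Lemma diff_mul1 : left_id diff_one diff_mul.
Proof. by move=> a; exact: diff_plus_inj. Qed.

Lemma diff_1mul : right_id diff_one diff_mul.
Proof. by move=> a; exact: diff_plus_inj. Qed.

Lemma diff_mulV : left_inverse diff_one diff_inv diff_mul.
Proof.
by move=> a; apply: diff_plus_inj; apply/funext => x; exact: diff_funK.
Qed.

Lemma diff_Vmul : right_inverse diff_one diff_inv diff_mul.
Proof.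
by move=> a; apply: diff_plus_inj; apply/funext => x; exact: diff_inv_funK.
Qed.

HB.instance Definition _ := gen_eqMixin (diff_plus e).
HB.instance Definition _ := gen_choiceMixin (diff_plus e).
HB.instance Definition _ := isGroup.Build (diff_plus e)
  diff_mulA diff_mul1 diff_1mul diff_mulV diff_Vmul.

End GroupInstance.

(* Main.v *)
Require Import Defs.
From mathcomp Require Import all_boot all_order all_algebra.
From mathcomp Require Import zify lra.
From mathcomp Require Import all_classical all_reals all_analysis.
Import Order.TTheory GRing.Theory Num.Theory.

(** Compare two elements of [Gamma] by their germs at 0: say that [a] is
    positive when [x < a x] for all small [x > 0].  Positivity is stable under
    products and under conjugation, and since a nontrivial element of [Gamma]
    has finitely many fixed points in (0, 1), it has none close to 0, so that
    either it or its inverse is positive ([germ_pos_total]).  Thus the germs at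
    0 turn [Gamma] into a bi-ordered group.  Call [f] infinitesimal with respect
    to [h], written f << h below, when [f ^+ n < h] for all [n].  The theorem
    follows from two facts about chains f_0 << f_1 << ... << f_n of positive
    elements, called towers of height [n].

    Algebra ([no_tower_derived_series]).  If a subgroup [H] contains no tower of
    height [n], its [n]-th derived subgroup is trivial.  By induction it is
    enough that the commutator subgroup of [H] contains no tower of height
    [n - 1].  If [f] were on top of such a tower, no positive element [g] of
    [H] could satisfy f << g, so the powers of [f] would be cofinal in
    [H].  The counting argument of Hoelder then shows that commutators in [H]
    are infinitesimal with respect to [f] ([commg_infinitesimal]): write x^n and
    y^n up to one factor [f] as powers of [f]; whatever the order of the letters,
    (xy)^n and (yx)^n are then both known up to two factors [f], so that the
    [n]-th power of the commutator stays bounded.  But [f] is itself a product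
    of commutators, and is not infinitesimal with respect to itself.

    Dynamics ([tower_height]).  A tower of height [n] in [Gamma] produces an
    element of [Gamma] with [n] fixed points in (0, 1), hence [n <= N].  Climb
    the tower.  Suppose that [W], of the size of [f], is positive and that points
    z_1 < ... < z_n are pushed by [W] alternately to the left and to the right,
    and let f << h.  Consider h^-1 W^k.  Near 0 its germ is negative, since [h]
    dominates every power of [W].  But choose first a point [z] below [z_1] in
    the range where [W] moves points to the right; for [k] large W^k carries [z]
    past the image of [z] under [h], so that h^-1 W^k moves [z] to the right.  So
    one more change of sign has appeared, between 0 and [z].  The previous ones
    survive if [W] pushes the [z_i] by more than [h] can undo; this is why
    the induction ([swingingS]) asks for pushes that exceed a germ [F] given in
    advance: to get pushes beyond [F] for h^-1 W^k, ask for pushes beyond [h F]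
    for [W].  Between two points moved in opposite directions there is a fixed
    point.

    So [Gamma] has no tower of height [N + 1], and its derived series reaches 1
    after [N + 1] steps. *)

Set Implicit Arguments.
Unset Strict Implicit.
Unset Printing Implicit Defensive.

Local Open Scope classical_set_scope.
Local Open Scope ring_scope.

(** * Subgroups and commutators *)

Section Subgroups.
Local Open Scope group_scope.
Variable G : groupType.
Implicit Types (a b : G) (H : set G) (n : nat).

Lemma subgroup1 H : subgroup H -> H 1.
Proof. by move=> [+ _]; rewrite inE. Qed.

Lemma subgroupV H a : subgroup H -> H a -> H a^-1.
Proof.
by move=> HG Ha; have := group_closedV HG; move=> /(_ a); rewrite !inE; exact.
Qed.

Lemma subgroupM H a b : subgroup H -> H a -> H b -> H (a * b).
Proof.
by move=> HG Ha Hb; have := group_closedM HG; move=> /(_ a b); rewrite !inE; exact.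
Qed.

Lemma subgroupX H a n : subgroup H -> H a -> H (a ^+ n).
Proof.
move=> HG Ha; elim: n => [|n IH]; first exact: subgroup1.
by rewrite expgS; exact: subgroupM.
Qed.

Lemma subgroupR H a b : subgroup H -> H a -> H b -> H [~ a, b].
Proof.
move=> HG Ha Hb; apply: (subgroupM HG); first exact: subgroupV.
apply: (subgroupM HG); first exact: subgroupV.
exact: subgroupM.
Qed.

Lemma derived_seriesSr H n :
  derived_series H n.+1 = derived_series (commutator_subgroup H) n.
Proof. by elim: n => // n IH; rewrite [RHS]/= -IH. Qed.

Lemma commutator_subgroupG H : subgroup (commutator_subgroup H).
Proof.
split; first by rewrite inE => K [[+ _] _]; rewrite inE.
move=> a b; rewrite !inE => Ha Hb K [KG KH].
by apply: subgroupM => //; [apply: Ha | apply: subgroupV => //; apply: Hb].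
Qed.

Lemma commutator_subgroup_sub H : subgroup H -> commutator_subgroup H `<=` H.
Proof.
move=> HG; apply: smallest_sub => // _ [x [y [Hx Hy ->]]].
exact: subgroupR.
Qed.

End Subgroups.

(** * Bi-invariant orders *)

Section GroupOrder.
Local Open Scope group_scope.
Variables (G : groupType) (pos : set G).
Hypothesis pos1 : ~ pos 1.
Hypothesis posM : forall a b, pos a -> pos b -> pos (a * b).
Hypothesis posJ : forall a b, pos a -> pos (a ^ b).
Implicit Types (a b c f g h x y : G) (H : set G) (m n : nat).

Definition glt a b : Prop := pos (a^-1 * b).
Definition gle a b : Prop := a = b \/ glt a b.

Lemma gltxx a : ~ glt a a.
Proof. by rewrite /glt mulVg. Qed.

Lemma glt1 a : glt 1 a = pos a.
Proof. by rewrite /glt invg1 mul1g. Qed.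

Lemma glt_trans b a c : glt a b -> glt b c -> glt a c.
Proof. by move=> ab bc; have := posM ab bc; rewrite mulgA mulgK. Qed.

Lemma glt_mul2l c a b : glt (c * a) (c * b) = glt a b.
Proof. by rewrite /glt invgM mulgA mulgVK. Qed.

Lemma glt_mul2r c a b : glt a b -> glt (a * c) (b * c).
Proof. by move=> /(@posJ _ c); rewrite /glt invgM conjgE !mulgA. Qed.

Lemma glt_inv a b : glt a b -> glt b^-1 a^-1.
Proof.
by move=> /(@glt_mul2r b^-1); rewrite -(@glt_mul2l a^-1) mulgV mulg1 mulKg.
Qed.

Lemma gle_refl a : gle a a. Proof. by left. Qed.

Lemma gltW a b : glt a b -> gle a b. Proof. by right. Qed.

Lemma gle_trans b a c : gle a b -> gle b c -> gle a c.
Proof.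
move=> [->//|ab] [<-|bc]; first exact: gltW.
exact/gltW/(glt_trans ab).
Qed.

Lemma gle_lt_trans b a c : gle a b -> glt b c -> glt a c.
Proof. by move=> [->//|ab]; exact: glt_trans. Qed.

Lemma glt_geF a b : glt a b -> ~ gle b a.
Proof. by move=> ab /gle_lt_trans/(_ ab)/gltxx. Qed.

Lemma gle_mul2l c a b : gle a b -> gle (c * a) (c * b).
Proof. by move=> [->|ab]; [left | right; rewrite glt_mul2l]. Qed.

Lemma gle_mul2r c a b : gle a b -> gle (a * c) (b * c).
Proof. by move=> [->|ab]; [left | right; exact: glt_mul2r]. Qed.

Lemma gle_mul a b c d : gle a b -> gle c d -> gle (a * c) (b * d).
Proof. by move=> ab cd; apply: gle_trans (gle_mul2r _ ab) (gle_mul2l _ cd). Qed.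

Lemma gle_inv a b : gle a b -> gle b^-1 a^-1.
Proof. by move=> [->|ab]; [left | right; exact: glt_inv]. Qed.

Lemma gle_exp n a b : gle a b -> gle (a ^+ n) (b ^+ n).
Proof.
move=> ab; elim: n => [|n IH]; first exact: gle_refl.
by rewrite !expgS; exact: gle_mul.
Qed.

Lemma gle1_exp n a : gle 1 a -> gle 1 (a ^+ n).
Proof. by move=> /(@gle_exp n); rewrite expg1n. Qed.

(** In the word [(x * y) ^+ n], moving all the [y] to the left replaces factors
    [x * y] by [y * x], and so decreases it if [y * x <= x * y].  In the
    opposite case the next lemma moves the [x] to the left instead. *)
Lemma gle_mul_exp_sort x y n : gle (y * x) (x * y) ->
  gle (y ^+ n * x ^+ n) ((x * y) ^+ n).
Proof.
move=> yx; have yxX m : gle (y * x ^+ m) (x ^+ m * y).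
  elim: m => [|m IH]; first by rewrite mulg1 mul1g; exact: gle_refl.
  rewrite expgSr mulgA; apply: gle_trans (gle_mul2r x IH) _.
  by rewrite -!mulgA; exact: gle_mul2l.
elim: n => [|n IH]; first by rewrite mulg1; exact: gle_refl.
rewrite expgSr -mulgA; apply: gle_trans (gle_mul2l _ (yxX n.+1)) _.
rewrite expgSr [in X in gle _ X]expgSr.
rewrite !mulgA; exact: gle_mul2r (gle_mul2r _ IH).
Qed.

Lemma gle_sort_mul_exp x y n : gle (x * y) (y * x) ->
  gle (x ^+ n * y ^+ n) ((x * y) ^+ n).
Proof.
move=> xy; have xXy m : gle (x ^+ m * y) (y * x ^+ m).
  elim: m => [|m IH]; first by rewrite mulg1 mul1g; exact: gle_refl.
  rewrite expgS -mulgA; apply: gle_trans (gle_mul2l x IH) _.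
  by rewrite !mulgA; exact: gle_mul2r.
elim: n => [|n IH]; first by rewrite mulg1; exact: gle_refl.
rewrite [X in gle (X * _) _]expgSr [in X in gle X _]expgS -mulgA.
rewrite [in X in gle _ X]expgS.
have -> : x ^+ n * (x * (y * y ^+ n)) = x * (x ^+ n * y) * y ^+ n.
  by rewrite !mulgA -expgSr -expgS.
apply: gle_trans (gle_mul2r _ (gle_mul2l _ (xXy n))) _.
have -> : x * (y * x ^+ n) * y ^+ n = x * y * (x ^+ n * y ^+ n).
  by rewrite !mulgA.
exact: gle_mul2l.
Qed.

(** * Infinitesimals and the derived series *)

Section Archimedean.
Variable Gamma : set G.
Hypothesis GammaG : subgroup Gamma.
Hypothesis pos_total : forall g, Gamma g -> [\/ g = 1, pos g | pos g^-1].

Lemma gle_total a b : Gamma a -> Gamma b -> gle a b \/ glt b a.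
Proof.
move=> Ga Gb; have Gab := subgroupM GammaG (subgroupV GammaG Ga) Gb.
have [ab1|ab|ba] := pos_total Gab; [left; left | left; right | right] => //.
  by rewrite -[RHS](mulVKg a) ab1 mulg1.
by move: ba; rewrite invgM invgK.
Qed.

(** One of [x ^+ n * y ^+ n] and [y ^+ n * x ^+ n] lies below [(x * y) ^+ n];
    which one does not matter if the lower bounds commute. *)
Lemma gle_expM u v x y n : Gamma x -> Gamma y -> commute u v ->
  gle u (x ^+ n) -> gle v (y ^+ n) -> gle (u * v) ((x * y) ^+ n).
Proof.
move=> Gx Gy uv ux vy.
have [xy|/gltW yx] := gle_total (subgroupM GammaG Gx Gy) (subgroupM GammaG Gy Gx).
  exact: gle_trans (gle_mul ux vy) (gle_sort_mul_exp n xy).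
by rewrite uv; apply: gle_trans (gle_mul vy ux) (gle_mul_exp_sort n yx).
Qed.

Lemma gexpM_le u v x y n : Gamma x -> Gamma y -> commute u v ->
  gle (x ^+ n) u -> gle (y ^+ n) v -> gle ((x * y) ^+ n) (u * v).
Proof.
move=> Gx Gy uv /gle_inv xu /gle_inv yv.
rewrite -[(x * y) ^+ n]invgK -[u * v]invgK; apply: gle_inv.
rewrite -expVgn !invgM; apply: gle_expM; rewrite ?expVgn//.
- exact: subgroupV GammaG Gy.
- exact: subgroupV GammaG Gx.
- exact/commute_sym/commuteV/commute_sym/commuteV.
Qed.

(** For positive [f] and [h] this is the usual relation between archimedean
    classes; it allows [f] to be negative. *)
Definition infinitesimal f h : Prop := forall n, glt (f ^+ n) h.

Section Hoelder.
Variables (H : set G) (h : G).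
Hypotheses (HG : subgroup H) (HGamma : H `<=` Gamma).
Hypotheses (Hh : H h) (h0 : pos h).
Hypothesis h_top : forall f, H f -> pos f -> ~ infinitesimal h f.

(** Integer powers of [h], the exponent [m - n] being given by two natural
    numbers: the integer parts below are taken for elements of both signs. *)
Let zexp m n := h ^+ m * h ^- n.

Lemma zexpM m n p q : zexp m n * zexp p q = zexp (m + p) (n + q).
Proof.
rewrite /zexp expgnDr addnC expgnDr invgM !mulgA; congr (_ * _).
rewrite -!mulgA; congr (_ * _); apply/commute_sym/commuteV.
exact: commuteX2.
Qed.

Lemma top_bound g : H g -> exists m, gle g (h ^+ m).
Proof.
move=> Hg; have [g1|g0|gV0] := pos_total (HGamma Hg).
- by exists 0%N; left.
- have /existsNP[m hg] := h_top Hg g0; exists m.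
  have Ghm : Gamma (h ^+ m) by apply: subgroupX => //; exact: HGamma.
  by case: (gle_total (HGamma Hg) Ghm).
- by exists 0%N; right; rewrite /glt mulg1.
Qed.

Lemma zexp_floor g : H g ->
  exists m n, gle (zexp m n) g /\ gle g (zexp m.+1 n).
Proof.
move=> Hg; have [m gm] := top_bound Hg.
have [n /gle_inv] := top_bound (subgroupV HG Hg); rewrite invgK => ng.
pose P k := `[< gle g (zexp k n) >].
have exP : exists k, P k.
  by exists (m + n)%N; apply/asboolP; rewrite /zexp expgnDr mulgK.
have [[|k] /asboolP gk kmin] := ex_minnP exP.
  (* then [h ^- n] bounds [g] on both sides *)
  exists 0%N, n; split; first by rewrite /zexp mul1g.
  apply: gle_trans gk _; apply: gle_mul2r; rewrite expg1.
  by apply: gltW; rewrite glt1.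
exists k, n; split => //.
have Gkn : Gamma (zexp k n).
  by apply: HGamma; apply: subgroupM => //; [|apply: subgroupV => //];
    apply: subgroupX.
have [gk'|/gltW//] := gle_total (HGamma Hg) Gkn.
have /kmin : P k by exact/asboolP.
by rewrite ltnn.
Qed.

(** Hoelder's argument.  If [x ^+ n] and [y ^+ n] lie in [[h^a, h^(a+1)]] and
    [[h^c, h^(c+1)]], then [(y * x) ^+ n] and [(x * y) ^+ n] both lie in
    [[h^(a+c), h^(a+c+2)]].  As [x * y = y * x * [~ x, y]], this leaves no room
    for [[~ x, y] ^+ n] to exceed [h ^+ 3], and since [n] is arbitrary the bound
    on all powers improves from [h ^+ 3] to [h]. *)
Lemma commg_infinitesimal x y : H x -> H y -> infinitesimal [~ x, y] h.
Proof.
move=> Hx Hy; have Hxy := subgroupM HG Hx Hy.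
have Hyx := subgroupM HG Hy Hx.
have Hc := subgroupR HG Hx Hy.
have le3 n : ~ gle (h ^+ 3) ([~ x, y] ^+ n).
  move=> hc.
  have [a [b [xl xu]]] := zexp_floor (subgroupX n HG Hx).
  have [c [d [yl yu]]] := zexp_floor (subgroupX n HG Hy).
  have zC p q r s : commute (zexp p q) (zexp r s).
    by rewrite /commute !zexpM addnC [(q + s)%N]addnC.
  have lo : gle (zexp (c + a) (d + b) * zexp 3 0) ((x * y) ^+ n).
    rewrite commgC; apply: gle_expM; try exact: HGamma.
    - exact: zC.
    - by rewrite -zexpM; apply: gle_expM; try exact: HGamma.
    - by rewrite /zexp expg0 invg1 mulg1.
  have hi : gle ((x * y) ^+ n) (zexp (a.+1 + c.+1) (b + d)).
    by rewrite -zexpM; apply: gexpM_le; try exact: HGamma.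
  have := gle_trans lo hi; rewrite zexpM addn0 [(d + b)%N]addnC.
  apply: glt_geF; rewrite /zexp; apply: glt_mul2r.
  have -> : (c + a + 3 = (a.+1 + c.+1).+1)%N by lia.
  by rewrite -{1}[h ^+ _]mulg1 [in X in glt _ X]expgSr glt_mul2l glt1.
move=> n; have Gcn : Gamma ([~ x, y] ^+ n).
  by apply: subgroupX => //; exact: HGamma.
have [hc|//] := gle_total (HGamma Hh) Gcn.
by case: (le3 (n * 3)%N); rewrite expgnA; exact: gle_exp.
Qed.

(** Asking that the inverse be infinitesimal too turns the bound on commutators
    into a subgroup condition. *)
Lemma commutator_infinitesimal :
  commutator_subgroup H `<=` [set g | H g /\ infinitesimal g h].
Proof.
suff : commutator_subgroup H `<=`
    [set g | [/\ H g, infinitesimal g h & infinitesimal g^-1 h]].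
  by move=> + g => /[apply] -[].
apply: smallest_sub; last first.
  move=> _ [x [y [Hx Hy ->]]]; split; last by rewrite invgR; exact: commg_infinitesimal.
    exact: subgroupR.
  exact: commg_infinitesimal.
have infM a b : H a -> H b -> infinitesimal a h -> infinitesimal b h ->
    infinitesimal (a * b) h.
  move=> Ha Hb ah bh n.
  have [ab|/gltW ba] := gle_total (HGamma Ha) (HGamma Hb).
    apply: gle_lt_trans (bh (2 * n)%N); rewrite expgnA; apply: gle_exp.
    by rewrite expg2; apply: gle_mul2r.
  apply: gle_lt_trans (ah (2 * n)%N); rewrite expgnA; apply: gle_exp.
  by rewrite expg2; apply: gle_mul2l.
split.
  rewrite inE; split; first exact: subgroup1.
    by move=> n; rewrite expg1n glt1.
  by move=> n; rewrite invg1 expg1n glt1.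
move=> a b; rewrite !inE => -[Ha ah aVh] [Hb bh bVh]; split.
- exact: subgroupM (subgroupV HG Hb).
- by apply: infM => //; exact: subgroupV.
- by rewrite invgF; apply: infM => //; exact: subgroupV.
Qed.

End Hoelder.

Fixpoint tower H n h : Prop :=
  [/\ H h, pos h & if n is m.+1 then exists2 f, tower H m f & infinitesimal f h
                   else True].

Lemma tower_sub H K n h : H `<=` K -> tower H n h -> tower K n h.
Proof.
move=> HK; elim: n h => [|n IH] h [/HK Kh h0] /=; first by split.
by move=> [f /IH Kf fh]; split=> //; exists f.
Qed.

Lemma tower_top H n h : tower H n h -> H h /\ pos h.
Proof. by case: n => [|n] []. Qed.

(** Suppose that the commutator subgroup of [H] contains a tower of height [n]
    with top [f].  No [g] of [H] sits above [f], as it would complete a tower of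
    height [n + 1] in [H]; hence all elements of the commutator subgroup are
    infinitesimal with respect to [f], including [f] itself, which is absurd. *)
Lemma no_tower_derived_series n H : subgroup H -> H `<=` Gamma ->
  ~ (exists h, tower H n h) -> derived_series H n = [set 1].
Proof.
elim: n H => [|n IH] H HG HGamma noH.
  apply/seteqP; split => [g /= Hg|_ ->]; last exact: subgroup1.
  have [//|g0|g0] := pos_total (HGamma _ Hg); exfalso; apply: noH.
    by exists g.
  by exists g^-1; split=> //; exact: subgroupV.
have sH := commutator_subgroup_sub HG.
rewrite derived_seriesSr; apply: IH.
- exact: commutator_subgroupG.
- exact: subset_trans sH HGamma.
move=> [f tf].
have tHf := tower_sub sH tf; have [Hf f0] := tower_top tHf.
have f_top g : H g -> pos g -> ~ infinitesimal f g.
  by move=> Hg g0 fg; apply: noH; exists g; split=> //; exists f.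
have [_ ff] := commutator_infinitesimal HG HGamma Hf f0 f_top (tower_top tf).1.
exact: f_top ff.
Qed.

End Archimedean.
End GroupOrder.

(** * The action on the interval *)

Section Dynamics.
Variables (R : realType) (e : R).
Local Notation G := (diff_plus e).
Implicit Types (a b f h F V W : G) (x y z u w r : I01 R) (zs : seq (I01 R)).

Lemma diffM a b x : (a * b)%g x = a (b x). Proof. by []. Qed.

Lemma diffVK a : cancel (a^-1)%g a. Proof. exact: diff_inv_funK. Qed.

Lemma ltr_diff a x y : (\val (a x) < \val (a y)) = (\val x < \val y).
Proof.
have [_ mono _] := diff_funP a.
apply/idP/idP => [|/mono//]; rewrite ltNge => /negP ayx.
rewrite ltNge; apply/negP; rewrite le_eqVlt => /orP[/eqP/val_inj yx|/mono/ltW//].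
by apply: ayx; rewrite yx.
Qed.

Lemma ler_diff a x y : (\val (a x) <= \val (a y)) = (\val x <= \val y).
Proof. by rewrite !leNgt ltr_diff. Qed.

Lemma diff_gt0 a x : 0 < \val x -> 0 < \val (a x).
Proof.
move=> x0; have v0 : \val (clip 0 : I01 R) = 0 by rewrite val_clip ?lexx ?ler01.
apply: (@le_lt_trans _ _ (\val (a (clip 0)))).
  by have /andP[] := I01P (a (clip 0)).
by rewrite ltr_diff v0.
Qed.

Lemma ltr_diffV a x y : (\val ((a^-1)%g x) < \val y) = (\val x < \val (a y)).
Proof. by rewrite -(ltr_diff a) diffVK. Qed.

Lemma ltr_diffVr a x y : (\val x < \val ((a^-1)%g y)) = (\val (a x) < \val y).
Proof. by rewrite -(ltr_diff a) diffVK. Qed.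

(** The supremum of the points of [[x, y]] that [a] does not move to the left is
    fixed, because [a] is monotone (Knaster and Tarski). *)
Lemma fixed_between a x y : \val x < \val y ->
  \val x < \val (a x) -> \val (a y) < \val y ->
  exists z, [/\ \val x < \val z, \val z < \val y & a z = z].
Proof.
move=> xy xax ayy.
pose S : set R := [set t | exists z : I01 R,
  [/\ t = \val z, \val x <= \val z, \val z <= \val y & \val z <= \val (a z)]].
have Sx : S (\val x) by exists x; rewrite lexx !ltW.
have Sy : ubound S (\val y) by move=> _ [z [-> _ zy _]].
have supS : has_sup S by split; [exists (\val x) | exists (\val y)].
have xs : \val x <= sup S by exact: ub_le_sup supS.2 _ Sx.
have sy : sup S <= \val y by apply: ge_sup => //; exists (\val x).
have s01 : 0 <= sup S <= 1.
  have /andP[x0 _] := I01P x; have /andP[_ y1] := I01P y.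
  by rewrite (le_trans x0 xs) (le_trans sy y1).
pose s : I01 R := clip (sup S); have vs : \val s = sup S by exact: val_clip.
have sas : \val s <= \val (a s).
  rewrite vs; apply: ge_sup; first by exists (\val x).
  move=> _ [z [-> xz zy zaz]]; apply: (le_trans zaz); rewrite ler_diff vs.
  by apply: (ub_le_sup supS.2); exists z. 
have ass : \val (a s) <= \val s.
  rewrite [leRHS]vs; apply: (ub_le_sup supS.2); exists (a s); split=> //.
  - by apply: le_trans sas; rewrite vs.
  - by apply: le_trans (ltW ayy); rewrite ler_diff vs.
  - by rewrite ler_diff.
have as_s : a s = s by apply/val_inj/le_anti; rewrite sas ass.
exists s; split=> //.
- rewrite lt_neqAle vs xs andbT -vs; apply/eqP => /val_inj xE.
  by move: xax; rewrite xE as_s ltxx.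
- rewrite lt_neqAle vs sy andbT -vs; apply/eqP => /val_inj yE.
  by move: ayy; rewrite -yE as_s ltxx.
Qed.

(** If the orbit of [x] stayed below [w], its supremum [s] would satisfy
    [W^-1 s < s], and the orbit would jump over [s] one step after passing
    [W^-1 s]. *)
Lemma diff_exp_escape W x w r : 0 < \val x -> \val w <= \val r ->
  (forall u, 0 < \val u -> \val u <= \val r -> \val u < \val (W u)) ->
  exists k, \val w < \val ((W ^+ k)%g x).
Proof.
move=> x0 wr Wr; apply: contrapT => /forallNP noesc.
have Wkw k : \val ((W ^+ k)%g x) <= \val w by rewrite leNgt; apply/negP/noesc.
pose S := range (fun k => \val ((W ^+ k)%g x)).
have S0 : S (\val x) by exists 0%N.
have Sw : ubound S (\val w) by move=> _ [k _ <-].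
have supS : has_sup S by split; [exists (\val x) | exists (\val w)].
have xs : \val x <= sup S by exact: ub_le_sup supS.2 _ S0.
have sw : sup S <= \val w by apply: ge_sup => //; exists (\val x).
have s01 : 0 <= sup S <= 1.
  have /andP[_ w1] := I01P w.
  by rewrite (le_trans (ltW x0) xs) (le_trans sw w1).
pose s : I01 R := clip (sup S); have vs : \val s = sup S by exact: val_clip.
have sWs : \val ((W^-1)%g s) < sup S.
  by rewrite -vs ltr_diffV; apply: Wr; rewrite vs ?(lt_le_trans x0)// (le_trans sw).
have [_ [k _ <-]] := sup_gt (ex_intro _ _ S0) sWs.
rewrite ltr_diffV vs ltNge => /negP; apply.
by apply: (ub_le_sup supS.2); exists k.+1 => //; rewrite expgS.
Qed.

(** * Germs at 0 *)

Definition near0 (P : I01 R -> Prop) : Prop :=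
  exists r, 0 < \val r /\ forall x, 0 < \val x -> \val x <= \val r -> P x.

Lemma near0_and P Q : near0 P -> near0 Q -> near0 (fun x => P x /\ Q x).
Proof.
move=> [r [r0 rP]] [s [s0 sQ]].
have [rs|/ltW sr] := leP (\val r) (\val s); [exists r | exists s]; split=> // x x0 xr.
  by split; [exact: rP | exact: sQ (le_trans xr rs)].
by split; [exact: rP (le_trans xr sr) | exact: sQ].
Qed.

Lemma near0_comp a P : near0 P -> near0 (P \o a).
Proof.
move=> [r [r0 rP]]; exists ((a^-1)%g r); split; first exact: diff_gt0.
move=> x x0 xr /=; apply: rP; first exact: diff_gt0.
by rewrite -(diffVK a r) ler_diff.
Qed.

Lemma near0_lt r : 0 < \val r -> near0 (fun x => \val x < \val r).
Proof.
move=> r0; have r1 : 0 <= \val r / 2 <= 1.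
  have /andP[_ r1] := I01P r.
  by apply/andP; split; lra.
exists (clip (\val r / 2)); rewrite val_clip// divr_gt0//; split=> // x _ xr.
by apply: le_lt_trans xr _; rewrite ltr_pdivrMr// ltr_pMr// ltr1n.
Qed.

Lemma near0_ex P : near0 P -> exists x, 0 < \val x /\ P x.
Proof. by move=> [r [r0 rP]]; exists r; split=> //; exact: rP. Qed.

Lemma near0W P Q : (forall x, 0 < \val x -> P x -> Q x) -> near0 P -> near0 Q.
Proof. by move=> PQ [r [r0 rP]]; exists r; split=> // x x0 xr; apply/PQ/rP. Qed.

Definition germ_pos : set G := [set a | near0 (fun x => \val x < \val (a x))].

Lemma germ_pos1 : ~ germ_pos 1%g.
Proof. by move=> /near0_ex[x [_]]; rewrite ltxx. Qed.

Lemma germ_posM a b : germ_pos a -> germ_pos b -> germ_pos (a * b)%g.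
Proof.
move=> a0 b0; apply: near0W (near0_and a0 b0) => x x0 [xa xb].
by rewrite diffM (lt_trans xa)// ltr_diff.
Qed.

Lemma germ_posJ a b : germ_pos a -> germ_pos (a ^ b)%g.
Proof.
move=> /(near0_comp b); apply: near0W => x x0 xa.
by rewrite conjgE !diffM ltr_diffVr.
Qed.

(** [W] pushes to the right across the whole interval from [F^-1 z] to [F z],
    where [F] is a germ at least 1.  With an interval centred at [z] in this
    sense, pushing to the left across it, [W (F z) < F^-1 z], is the same
    condition for [W^-1]. *)
Definition drifts F W z : Prop := \val (F z) < \val (W ((F^-1)%g z)).

(** Inverting [W] from one point to the next makes the directions alternate,
    the first push being to the right. *)
Fixpoint swings F W zs : Prop :=
  if zs is z :: zs' then drifts F W z /\ swings F (W^-1)%g zs' else True.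

Lemma swings_imp F V F' V' (P : I01 R -> Prop) zs :
  (forall z, P z -> drifts F V z -> drifts F' V' z) ->
  (forall z, P z -> drifts F (V^-1)%g z -> drifts F' (V'^-1)%g z) ->
  (forall z, z \in zs -> P z) -> swings F V zs -> swings F' V' zs.
Proof.
elim: zs V V' => //= z zs IH V V' VV' VV'i zsP [Vz Vzs]; split.
  by apply: VV' => //; apply: zsP; rewrite mem_head.
apply: IH Vzs => //; first by rewrite !invgK.
by move=> u uzs; apply: zsP; rewrite in_cons uzs orbT.
Qed.

Lemma lt_exp_diff k W u w : \val u <= \val w -> \val w < \val (W u) ->
  \val w < \val ((W ^+ k.+1)%g u).
Proof.
move=> uw wWu; elim: k => [|k IH]; first by rewrite expg1.
rewrite expgS diffM; apply: lt_trans wWu _; rewrite ltr_diff.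
exact: le_lt_trans IH.
Qed.

(** * Towers of germs force fixed points *)

Section FixedPoints.
Variables (Gamma : set G) (N : nat).
Hypothesis GammaG : subgroup Gamma.
Hypothesis Gamma_fix : forall a, Gamma a -> a <> 1%g ->
  ([set x : I01 R | 0 < \val x < 1 /\ a x = x] #<= `I_N)%card.

Lemma near0_finite (A : set (I01 R)) : finite_set A -> near0 (fun x => ~ A x).
Proof.
move=> /finite_seqP[zs ->]; elim: zs => [|z zs IH].
  have v1 : \val (clip 1 : I01 R) = 1 by rewrite val_clip ?lexx ?ler01.
  by exists (clip 1); rewrite v1.
have [z0|z0] := leP (\val z) 0.
  apply: near0W IH => x x0 xzs /=; rewrite in_cons => /orP[/eqP xz|//].
  by move: x0; rewrite xz ltNge z0.
apply: near0W (near0_and IH (near0_lt z0)) => x x0 [xzs xz] /=.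
by rewrite in_cons => /orP[/eqP xE|//]; rewrite xE ltxx in xz.
Qed.

(** An element without fixed points in [(0, r]] moves all of these points in the
    same direction as [r]. *)
Lemma germ_pos_total a : Gamma a -> [\/ a = 1%g, germ_pos a | germ_pos a^-1%g].
Proof.
move=> Ga; have [->|/eqP a1] := eqVneq a 1%g; first by constructor 1.
have fin : finite_set [set x : I01 R | 0 < \val x < 1 /\ a x = x].
  exact: card_le_finite (Gamma_fix Ga a1) (finite_II _).
have v1 : \val (clip 1 : I01 R) = 1 by rewrite val_clip ?lexx ?ler01.
have lt1 : near0 (fun x => \val x < 1).
  by rewrite -v1; apply: near0_lt; rewrite v1.
have [r [r0 rfix]] := near0_and (near0_finite fin) lt1.
have nofix x : 0 < \val x -> \val x <= \val r -> a x <> x.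
  by move=> x0 xr ax; have [+ x1] := rfix _ x0 xr; apply; split; rewrite ?x0.
have [rar|arr|/val_inj ar] := ltgtP (\val r) (\val (a r)); last by case: (nofix r).
- constructor 2; exists r; split=> // x x0 xr.
  rewrite ltNge le_eqVlt; apply/negP => /orP[/eqP/val_inj|axx]; first exact: nofix.
  have xr' : \val x < \val r.
    by rewrite lt_neqAle xr andbT; apply/eqP => /val_inj xE; move: axx; rewrite xE ltNge ltW.
  have [||z [xz zr az]] := @fixed_between (a^-1)%g x r xr'.
  + by rewrite ltr_diffVr.
  + by rewrite ltr_diffV.
  by apply: (nofix z); rewrite ?(lt_trans x0) ?ltW// -[in LHS]az diffVK.
- constructor 3; exists r; split=> // x x0 xr.
  rewrite ltr_diffVr.
  rewrite ltNge le_eqVlt; apply/negP => /orP[/eqP/val_inj/esym|xax]; first exact: nofix.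
  have xr' : \val x < \val r.
    by rewrite lt_neqAle xr andbT; apply/eqP => /val_inj xE; move: xax; rewrite xE ltNge ltW.
  have [z [xz zr az]] := fixed_between xr' xax arr.
  by apply: (nofix z); rewrite ?(lt_trans x0) ?ltW.
Qed.

Local Notation gle := (gle germ_pos).
Local Notation glt := (glt germ_pos).

(** There are elements of [Gamma] of size at most [f] whose displacement changes
    sign [n] times, arbitrarily close to 0 and by pushes as strong as desired:
    the germ of [W] is positive and the pushes at [zs], listed from 0 upwards,
    start with one to the left. *)
Definition swinging n f : Prop := forall F r, gle 1%g F -> 0 < \val r ->
  exists W zs, [/\ Gamma W, germ_pos W & exists m, gle W (f ^+ m)%g] /\
  [/\ size zs = n, path <%R 0 [seq \val z | z <- zs],
      (forall z, z \in zs -> \val z <= \val r) & swings F (W^-1)%g zs].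

Lemma swinging0 f : Gamma f -> germ_pos f -> swinging 0 f.
Proof.
by move=> Gf f0 F r F1 r0; exists f, [::]; do 2!split=> //; exists 1%N; left.
Qed.

Lemma germ_ge F : gle 1%g F -> near0 (fun x => \val x <= \val (F x)).
Proof.
case=> [<-|]; last by rewrite glt1; apply: near0W => x _ /ltW.
by exists (clip 1); rewrite val_clip ?ler01 ?lexx.
Qed.

(** From [W], with pushes beyond [h * F], pass to the inverse of
    [h^-1 * W ^+ k.+1].  Near 0, [h] wins over the powers of [W], so the germ is
    positive again.  A point [z] is chosen in the range where [W] moves points to
    the right, below the previous points; [k] is then taken so large that
    [h^-1 * W ^+ k.+1] pushes [z] to the right.  At the previous points taking
    powers of [W] only makes the pushes stronger, and the factor [h] costs no
    more than the difference between pushing beyond [h * F] and beyond [F]. *)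
Lemma swingingS n f h : Gamma h -> germ_pos h ->
  infinitesimal germ_pos f h -> swinging n f -> swinging n.+1 h.
Proof.
move=> Gh h0 fh Qf F r F1 r0.
pose F' := (h * F)%g.
have F'1 : gle 1%g F'.
  have h1 : gle 1%g h by right; rewrite glt1.
  by have := gle_mul germ_posM germ_posJ h1 F1; rewrite mul1g.
(* the inequalities between germs that the old and new points must satisfy *)
pose P z := [/\ \val z < \val (h z), \val ((F^-1)%g z) < \val (h ((F^-1)%g z)),
  \val (F z) < \val (h (F z)), \val z <= \val (F z) & \val z < \val r].
have nP : near0 P.
  have := near0_and (near0_and h0 (near0_comp (F^-1)%g h0))
    (near0_and (near0_comp F h0) (near0_and (germ_ge F1) (near0_lt r0))).
  by apply: near0W => x _ /= [[? ?] [? [? ?]]].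
have [r' [r'0 r'P]] := nP.
have [W [zs [[GW W0 [m Wfm]] [szs pzs zsr' Wzs]]]] := Qf F' r' F'1 r'0.
have zsP z : z \in zs -> P z.
  move=> zzs; apply: r'P; last exact: zsr'.
  have /allP := order_path_min lt_trans pzs.
  by apply; exact: map_f.
have [s [s0 sW]] := W0.
have hd : near0 (fun z => path <%R (\val z) [seq \val z | z <- zs]).
  case: (zs) pzs => [|u us] /=; first by exists (clip 1); rewrite val_clip ?ler01 ?lexx.
  by move=> /andP[u0 ->]; apply: near0W (near0_lt u0) => x _ ->.
have [z [z0 [Pz [zzs F'zs]]]] :=
  near0_ex (near0_and nP (near0_and hd (near0_comp F' (near0_lt s0)))).
have F'V u : (F'^-1)%g u = (F^-1)%g ((h^-1)%g u) by rewrite /F' invgM.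
have F'uu u : P u -> \val ((F'^-1)%g u) <= \val (F' u).
  case=> hu _ hFu Fu _; rewrite F'V.
  apply: (@le_trans _ _ (\val u)); last by rewrite (le_trans Fu)// ltW.
  apply: ltW; rewrite ltr_diffV ltr_diffV.
  by apply: lt_le_trans hu _; rewrite ler_diff.
have [k Wk] : exists k, \val (F' z) < \val ((W ^+ k.+1)%g ((F'^-1)%g z)).
  have V0 : 0 < \val ((F'^-1)%g z) by exact: diff_gt0.
  have [[|k] Wk] := diff_exp_escape V0 (ltW F'zs) sW; last by exists k.
  by have := F'uu z Pz; rewrite leNgt Wk.
have Vle u : P u -> \val ((F'^-1)%g u) <= \val ((F^-1)%g u).
  by case=> hu _ _ _ _; rewrite F'V ler_diff ltW// ltr_diffV.
pose W' := ((W ^+ k.+1)^-1 * h)%g.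
have W'V : (W'^-1 = h^-1 * W ^+ k.+1)%g by rewrite /W' invgM invgK.
have driftV u : P u -> \val (F' u) < \val ((W ^+ k.+1)%g ((F'^-1)%g u)) ->
    drifts F (W'^-1)%g u.
  move=> Pu Wu; rewrite /drifts W'V diffM ltr_diffVr.
  by apply: lt_le_trans Wu _; rewrite ler_diff; exact: Vle.
exists W', (z :: zs); split; split.
- apply: subgroupM => //; apply: subgroupV => //; exact: subgroupX.
- apply: gle_lt_trans (fh (m * k.+1)%N) => //; first exact: germ_posM.
  by rewrite expgnA; exact: (gle_exp germ_posM germ_posJ).
- exists 1%N; rewrite expg1 -[X in gle _ X]mul1g.
  apply: (gle_mul2r germ_posJ); rewrite -[X in gle _ X]invg1.
  apply: (gle_inv germ_posJ); apply: (gle1_exp germ_posM germ_posJ).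
  by right; rewrite glt1.
- by rewrite /= szs.
- by rewrite /= z0.
- move=> u; rewrite in_cons => /orP[/eqP ->|/zsP[_ _ _ _ /ltW//]].
  by case: Pz => _ _ _ _ /ltW.
- split; first exact: driftV Pz Wk.
  rewrite invgK; apply: (swings_imp _ _ zsP Wzs) => u Pu; last first.
    by rewrite invgK => Wu; apply: driftV => //; exact: lt_exp_diff (F'uu u Pu) Wu.
  move=> /(lt_exp_diff k (F'uu u Pu)); rewrite expVgn => WVu.
  have [_ hVu hFu _ _] := Pu; rewrite /drifts.
  apply: (lt_trans hFu); apply: (lt_le_trans WVu).
  by rewrite /W' diffM ler_diff (le_trans (Vle u Pu))// ltW.
Qed.

Lemma tower_swinging n h : tower germ_pos Gamma n h -> swinging n h.
Proof.
elim: n h => [|n IH] h [Gh h0]; first by move=> _; exact: swinging0.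
by move=> [f /IH Qf fh]; exact: swingingS Qf.
Qed.

(** For [F = 1] a drift is a displacement, and [fixed_between] applies to each
    pair of consecutive points, the role of [W] being taken in turn by [W] and
    [W^-1], which have the same fixed points. *)
Lemma swings_fixed W x zs : \val x < \val (W x) ->
  path <%R (\val x) [seq \val z | z <- zs] -> swings 1%g (W^-1)%g zs ->
  exists ps, [/\ size ps = size zs, path <%R (\val x) [seq \val p | p <- ps] &
    forall p, p \in ps -> \val p < 1 /\ W p = p].
Proof.
elim: zs W x => [|z zs IH] W x xWx /=; first by exists [::].
move=> /andP[xz pz] [zWz Wzs].
have Wzz : \val (W z) < \val z by move: zWz; rewrite /drifts invg1 ltr_diffVr.
have [p [xp pz' Wp]] := fixed_between xz xWx Wzz.
have [|ps [sps pps Wps]] := IH (W^-1)%g z _ pz Wzs.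
  by rewrite ltr_diffVr.
exists (p :: ps); split => /=; first by rewrite sps.
  rewrite xp /=; case: (ps) pps => //= q qs /andP[zq ->].
  by rewrite (lt_trans pz').
move=> q; rewrite in_cons => /orP[/eqP ->|/Wps[q1 Wq]].
  by split=> //; apply: lt_le_trans pz' _; have /andP[] := I01P z.
by split=> //; rewrite -[in LHS]Wq diffVK.
Qed.

Lemma tower_height n h : tower germ_pos Gamma n h -> (n <= N)%N.
Proof.
move=> /tower_swinging Qh.
have v1 : \val (clip 1 : I01 R) = 1 by rewrite val_clip ?lexx ?ler01.
have [||W [zs [[GW W0 _] [<- pzs _ Wzs]]]] := Qh 1%g (clip 1).
- exact: gle_refl.
- by rewrite v1.
have hd : near0 (fun z => path <%R (\val z) [seq \val z | z <- zs]).
  case: (zs) pzs => [|u us] /=; first by exists (clip 1); rewrite v1.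
  by move=> /andP[u0 ->]; apply: near0W (near0_lt u0) => x _ ->.
have [x [x0 [xW xzs]]] := near0_ex (near0_and W0 hd).
have [ps [<- pps Wps]] := swings_fixed xW xzs Wzs.
have ps_uniq : uniq ps.
  apply: (map_uniq (f := \val)); apply: (sorted_uniq lt_trans ltxx).
  exact: path_sorted pps.
have W1 : W <> 1%g by move=> W1; rewrite W1 in W0; exact: germ_pos1 W0.
have nth_inj : {in `I_(size ps) &, injective (nth x ps)}.
  by move=> i k; rewrite !inE => /= ilt klt /eqP; rewrite nth_uniq// => /eqP.
rewrite -card_le_II -(card_le_eql (inj_card_eq nth_inj)).
apply: card_le_trans (Gamma_fix GW W1); apply: subset_card_le => _ [i /= ilt <-].
have ip := mem_nth x ilt; have [p1 Wp] := Wps _ ip; split=> //.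
rewrite p1 andbT; apply: lt_trans x0 _.
by have /allP := order_path_min lt_trans pps; apply; exact: map_f.
Qed.

End FixedPoints.

End Dynamics.

(** * The theorem *)

Theorem theorem0p1 (R : realType) (e : R) (N : nat) (Gamma : set (diff_plus e))
    (e01 : 0 < e < 1)
    (GammaG : subgroup Gamma)
    (Gamma_fix : forall a : diff_plus e, Gamma a -> a <> 1%g ->
       ([set x : I01 R | 0 < \val x < 1 /\ a x = x] #<= `I_N)%card) :
  solvable_subgroup Gamma.
Proof.
exists N.+1; have tot := @germ_pos_total R e Gamma N Gamma_fix.
apply: (no_tower_derived_series (@germ_pos1 R e) (@germ_posM R e)
  (@germ_posJ R e) GammaG tot) => //.
by move=> [h /(tower_height GammaG Gamma_fix)]; rewrite ltnn.
Qed.
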